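(* Let $B=\begin{pmatrix}p&q&0\\ q&p&0\\ 0&0&r\end{pmatrix}$ with $p,q,r\in\mathbb{R}$, $p>|q|$ and $r>0$. Then $F\in\mathrm{GL}^+(3)$ with $FF^T=B$ is uniquely determined, up to an arbitrary $Q\in\mathrm{SO}(3)$, by $$F=\begin{pmatrix}1&\gamma&0\\0&1&0\\0&0&1\end{pmatrix}\begin{pmatrix}a&0&0\\0&b&0\\0&0&c\end{pmatrix}Q,$$ where $$a=\sqrt{\frac{p^2-q^2}{p}},\qquad b=\sqrt{p}=\sqrt{B_{11}},\qquad c=\sqrt{r},\qquad \gamma=\frac{q}{p};$$ that is, $F\in\mathrm{GL}^+(3)$ satisfies $FF^T=B$ if and only if $F$ has this form for some $Q\in\mathrm{SO}(3)$. In terms of the singular values $\lambda_1,\lambda_2,\lambda_3>0$ of $F$, labelled such that $\lambda_1^2=p+q$, $\lambda_2^2=p-q$, $\lambda_3^2=r$, $$a=\lambda_1\lambda_2\sqrt{\frac{2}{\lambda_1^2+\lambda_2^2}},\qquad b=\sqrt{\frac{\lambda_1^2+\lambda_2^2}{2}},\qquad c=\lambda_3,\qquad \gamma=\frac{\lambda_1^2-\lambda_2^2}{\lambda_1^2+\lambda_2^2}.$$ In particular, if $\hat\sigma$ is an isotropic Cauchy stress response such that $\hat\sigma(B')=0$ if and only if $B'=\mathbb{1}$, and if $F\in\mathrm{GL}^+(3)$ satisfies $\hat\sigma(FF^T)=s\,(e_1\otimes e_2+e_2\otimes e_1)$ for some $s\in\mathbb{R}$, then $F$ is necessarily of the form $$F=\begin{pmatrix}1&\gamma&0\\0&1&0\\0&0&1\end{pmatrix}\begin{pmatrix}a&0&0\\0&b&0\\0&0&c\end{pmatrix}Q$$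 with $a=\sqrt{\frac{p^2-q^2}{p}}$, $b=\sqrt{p}$, $c=\sqrt{r}$, $\gamma=\frac{q}{p}$ for some $p,q,r\in\mathbb{R}$ with $p>|q|$, $r>0$, and some $Q\in\mathrm{SO}(3)$.
   Context: $\mathrm{GL}^+(3)$ denotes the real $3\times3$ matrices with positive determinant, $\mathrm{Sym}(3)$ the symmetric real $3\times 3$ matrices, $\mathrm{Sym}^+(3)$ the positive definite symmetric ones, and $\mathbb{1}$ the identity matrix. An isotropic Cauchy stress response is a map $\hat\sigma:\mathrm{Sym}^+(3)\to\mathrm{Sym}(3)$ with $\hat\sigma(QBQ^T)=Q\hat\sigma(B)Q^T$ for all $Q\in\mathrm{SO}(3)$ and $B\in\mathrm{Sym}^+(3)$; the Cauchy stress corresponding to a deformation gradient $F\in\mathrm{GL}^+(3)$ is $\hat\sigma(FF^T)$. Here $s\,(e_1\otimes e_2+e_2\otimes e_1)=\begin{pmatrix}0&s&0\\ s&0&0\\ 0&0&0\end{pmatrix}$. *)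

(* Defs.v *)
From mathcomp Require Import all_boot all_order all_algebra.
From mathcomp Require Import reals.

Set Implicit Arguments.
Unset Strict Implicit.
Unset Printing Implicit Defensive.

Import Order.TTheory GRing.Theory Num.Theory.
Local Open Scope ring_scope.

Section Defs.
Variable R : realType.

Definition mx33 (a00 a01 a02 a10 a11 a12 a20 a21 a22 : R) : 'M[R]_3 :=
  \matrix_(i < 3, j < 3)
    nth 0 (nth [::] [:: [:: a00; a01; a02];
                        [:: a10; a11; a12];
                        [:: a20; a21; a22]] i) j.

Definition GLpos (F : 'M[R]_3) : Prop := 0 < \det F.

Definition SO (Q : 'M[R]_3) : Prop := Q *m Q^T = 1%:M /\ \det Q = 1.

Definition Sym (A : 'M[R]_3) : Prop := A^T = A.

Definition SymPos (A : 'M[R]_3) : Prop :=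
  Sym A /\ forall x : 'cV[R]_3, x != 0 -> 0 < (x^T *m A *m x) 0 0.

(* A map from Sym^+(3) to Sym(3) is represented by a total function on
   matrices; its values outside Sym^+(3) are unconstrained and never used. *)
Definition isotropic_stress_response (sigma : 'M[R]_3 -> 'M[R]_3) : Prop :=
  (forall B, SymPos B -> Sym (sigma B)) /\
  (forall Q B, SO Q -> SymPos B ->
     sigma (Q *m B *m Q^T) = Q *m sigma B *m Q^T).

(* The singular values are the nonnegative square roots of the eigenvalues of
   F^T F, listed with multiplicity and in arbitrary order. *)
Definition singular_values (F : 'M[R]_3) (s : seq R) : Prop :=
  all (fun x => 0 <= x) s /\
  char_poly (F^T *m F) = \prod_(x <- s) ('X - (x ^+ 2)%:P).

End Defs.

(* Main.v *)
(* Let M be the product of the shear and the diagonal stretch. Then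
   M M^T = B and det M > 0, so F F^T = B with det F > 0 exactly when M^-1 F is a
   rotation.
   For the last part, isotropy makes every eigenvector of B = F F^T an
   eigenvector of the stress. If s <> 0 the stress has the three simple
   eigendirections e1 + e2, e1 - e2 and e3, which must therefore be those of B;
   if s = 0 then B = 1 by hypothesis. *)
Require Import Defs.
From mathcomp Require Import all_boot all_order all_algebra.
From mathcomp Require Import reals ring lra.
From mathcomp.real_closed Require Import polyrcf.

Set Implicit Arguments.
Unset Strict Implicit.
Unset Printing Implicit Defensive.

Import Order.TTheory GRing.Theory Num.Theory.
Local Open Scope ring_scope.

(** * Determinants and characteristic polynomials *)

Lemma det_mx3 (S : comNzRingType) (A : 'M[S]_3) :
  \det A = A 0 0 * (A 1 1 * A 2 2 - A 1 2 * A 2 1)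
         - A 0 1 * (A 1 0 * A 2 2 - A 1 2 * A 2 0)
         + A 0 2 * (A 1 0 * A 2 1 - A 1 1 * A 2 0).
Proof.
(* Indexing the entries by natural numbers lets the nested lifted ordinals of the cofactor expansion
   reduce by computation. *)
pose f (i j : nat) := A (inord i) (inord j).
have {1}-> : A = \matrix_(i, j) f i j.
  by apply/matrixP => i j; rewrite mxE /f !inord_val.
have AE (i j : 'I_3) : A i j = f i j by rewrite /f !inord_val.
rewrite !AE (expand_det_row _ 0) !big_ord_recl big_ord0 /cofactor.
rewrite !(expand_det_row _ 0) !big_ord_recl !big_ord0 /cofactor !det_mx11 !mxE /=.
rewrite /bump /=; ring.
Qed.

(** Over the polynomials, A (X - B A) = (X - A B) A, and the unit det A cancels after taking
    determinants. It transfers the spectrum of F F^T to F^T F, whose eigenvalues are the squared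
    singular values. *)
Lemma char_poly_mulC (K : fieldType) (n : nat) (A B : 'M[K]_n) :
  A \in unitmx -> char_poly (B *m A) = char_poly (A *m B).
Proof.
move=> uA; set PA := map_mx polyC A.
have uPA : \det PA \is a GRing.unit.
  by rewrite det_map_mx rmorph_unit // -unitmxE.
have eqM : PA *m char_poly_mx (B *m A) = char_poly_mx (A *m B) *m PA.
  by rewrite /char_poly_mx mulmxBr mulmxBl scalar_mxC !map_mxM /= !mulmxA.
apply: (mulrI uPA); rewrite /char_poly -det_mulmx eqM det_mulmx.
by rewrite mulrC.
Qed.

(** * Explicit 3 x 3 matrices and rows *)

Section Mx33.
Variable R : realType.
Implicit Types (A B F Q : 'M[R]_3) (v w : 'rV[R]_3).

Lemma mx33E A :
  A = mx33 (A 0 0) (A 0 1) (A 0 2) (A 1 0) (A 1 1) (A 1 2) (A 2 0) (A 2 1) (A 2 2).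
Proof.
by apply/matrixP => -[[|[|[|//]]] ?] -[[|[|[|//]]] ?]; rewrite mxE /=;
  congr (A _ _); apply/val_inj.
Qed.

Lemma mul_mx33 (a b c d e f g h i a' b' c' d' e' f' g' h' i' : R) :
  mx33 a b c d e f g h i *m mx33 a' b' c' d' e' f' g' h' i' =
  mx33 (a * a' + b * d' + c * g') (a * b' + b * e' + c * h') (a * c' + b * f' + c * i')
       (d * a' + e * d' + f * g') (d * b' + e * e' + f * h') (d * c' + e * f' + f * i')
       (g * a' + h * d' + i * g') (g * b' + h * e' + i * h') (g * c' + h * f' + i * i').
Proof.
by apply/matrixP => -[[|[|[|//]]] ?] -[[|[|[|//]]] ?];
  rewrite !mxE !big_ord_recl big_ord0 !mxE /= addr0 addrA.
Qed.

Lemma tr_mx33 (a b c d e f g h i : R) :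
  (mx33 a b c d e f g h i)^T = mx33 a d g b e h c f i.
Proof. by apply/matrixP => -[[|[|[|//]]] ?] -[[|[|[|//]]] ?]; rewrite !mxE. Qed.

Lemma det_mx33 (a b c d e f g h i : R) :
  \det (mx33 a b c d e f g h i) =
  a * (e * i - f * h) - b * (d * i - f * g) + c * (d * h - e * g).
Proof. by rewrite det_mx3 !mxE. Qed.

Definition row3 (x y z : R) : 'rV[R]_3 := \row_j nth 0 [:: x; y; z] j.

Lemma row3E v : v = row3 (v 0 0) (v 0 1) (v 0 2).
Proof.
by apply/rowP => -[[|[|[|//]]] ?]; rewrite mxE /=; congr (v _ _); apply/val_inj.
Qed.

Lemma row3_inj (x y z x' y' z' : R) :
  row3 x y z = row3 x' y' z' -> [/\ x = x', y = y' & z = z'].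
Proof.
move=> /rowP E; move: (E 0) (E 1) (E 2); by rewrite !mxE.
Qed.

Lemma row3_eq0 (x y z : R) : (row3 x y z == 0) = [&& x == 0, y == 0 & z == 0].
Proof.
apply/eqP/and3P => [/rowP E|[/eqP-> /eqP-> /eqP->]].
  by move: (E 0) (E 1) (E 2); rewrite !mxE /= => -> -> ->.
by apply/rowP => -[[|[|[|//]]] ?]; rewrite !mxE.
Qed.

Lemma scale_row3 (k x y z : R) : k *: row3 x y z = row3 (k * x) (k * y) (k * z).
Proof. by apply/rowP => -[[|[|[|//]]] ?]; rewrite !mxE. Qed.

Lemma mul_row3_mx33 (x y z a b c d e f g h i : R) :
  row3 x y z *m mx33 a b c d e f g h i =
  row3 (x * a + y * d + z * g) (x * b + y * e + z * h) (x * c + y * f + z * i).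
Proof.
by apply/rowP => -[[|[|[|//]]] ?];
  rewrite !mxE !big_ord_recl big_ord0 !mxE /= addr0 addrA.
Qed.

(** * Half-turns and isotropic responses *)

Lemma mulmx_tr_gt0 v : v != 0 -> 0 < (v *m v^T) 0 0.
Proof.
move=> v0; rewrite !mxE.
have ge i : true -> 0 <= v 0 i * v^T i 0 by rewrite mxE -expr2 sqr_ge0.
rewrite lt_def sumr_ge0 // andbT psumr_eq0 //; apply: contra v0 => /allP E.
apply/eqP/rowP => i; move/(_ i): E; rewrite mem_index_enum => /(_ isT).
by rewrite !mxE mulf_eq0 orbb => /eqP.
Qed.

(* This is the rotation by pi about the axis v. *)
Lemma half_turn v : v != 0 ->
  SO ((2 / (v *m v^T) 0 0) *: (v^T *m v) - 1%:M).
Proof.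
move=> /mulmx_tr_gt0; rewrite (row3E v); move: (v 0 0) (v 0 1) (v 0 2) => x y z.
set w := row3 x y z.
have -> : (w *m w^T) 0 0 = x ^+ 2 + y ^+ 2 + z ^+ 2.
  by rewrite !mxE !big_ord_recl big_ord0 !mxE /=; ring.
set n := _ + _ => n0.
have -> : (2 / n) *: (w^T *m w) - 1%:M =
  mx33 (2 / n * (x * x) - 1) (2 / n * (x * y)) (2 / n * (x * z))
       (2 / n * (y * x)) (2 / n * (y * y) - 1) (2 / n * (y * z))
       (2 / n * (z * x)) (2 / n * (z * y)) (2 / n * (z * z) - 1).
  by apply/matrixP => -[[|[|[|//]]] ?] -[[|[|[|//]]] ?];
    rewrite !mxE big_ord1 !mxE /= ?subr0.
have n1 : n != 0 by rewrite gt_eqF.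
split.
  rewrite tr_mx33 mul_mx33 [RHS]mx33E !mxE /=.
  by congr mx33; rewrite /n in n1 *; field.
by rewrite det_mx33 /n in n1 *; field.
Qed.

(* A half-turn about an eigenvector of B commutes with B, hence with sigma B
   by isotropy, and its axis is then an eigenvector of sigma B. *)
Lemma isotropic_eigenvector (sigma : 'M[R]_3 -> 'M[R]_3) B v l :
  isotropic_stress_response sigma -> SymPos B ->
  v != 0 -> v *m B = l *: v -> exists m, v *m sigma B = m *: v.
Proof.
move=> [_ iso] posB v0 vB.
have SOQ := half_turn v0; have n0 := mulmx_tr_gt0 v0.
move: SOQ; set n := _ 0 0 in n0 *; set Q := _ - _ => SOQ.
have QTQ : Q^T *m Q = 1%:M by apply: mulmx1C; case: SOQ.
have Bv : B *m v^T = l *: v^T.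
  by case: posB => symB _; rewrite -[in LHS]symB -trmx_mul vB linearZ.
have QB : Q *m B = B *m Q.
  rewrite mulmxBl mulmxBr mul1mx mulmx1 -scalemxAl -scalemxAr -mulmxA vB.
  by rewrite mulmxA Bv -scalemxAl -scalemxAr.
have QBQ : Q *m B *m Q^T = B by rewrite QB -mulmxA (proj1 SOQ) mulmx1.
have := iso Q B SOQ posB; rewrite QBQ; set S := sigma B => E.
have QS : Q *m S = S *m Q by rewrite [in RHS]E -!mulmxA QTQ mulmx1.
(* [Q] is a nonzero multiple of v^T v minus the identity, so what commutes with [Q] commutes with
   v^T v. *)
have vS : v^T *m v *m S = S *m (v^T *m v).
  have := QS; rewrite mulmxBl mulmxBr mul1mx mulmx1 => /addIr.
  rewrite -scalemxAl -scalemxAr => /(scalerI _); apply.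
  by rewrite mulf_neq0 ?invr_eq0 ?gt_eqF // pnatr_eq0.
have vv : v *m v^T = n%:M by rewrite [LHS]mx11_scalar.
(* The eigenvalue is the Rayleigh quotient of [S] at [v]: multiplying [vS] by [v] on the left turns
   v v^T into the scalar [n]. *)
exists (n^-1 * (v *m S *m v^T) 0 0).
have nvS : n *: (v *m S) = (v *m S *m v^T) 0 0 *: v.
  have : v *m (v^T *m v *m S) = v *m (S *m (v^T *m v)) by rewrite vS.
  rewrite !mulmxA vv -(mulmxA _ v S) mul_scalar_mx => ->.
  by rewrite [in LHS](mx11_scalar (v *m S *m v^T)) mul_scalar_mx.
by rewrite -scalerA -nvS scalerK // gt_eqF.
Qed.

(** * Matrices whose eigenvectors are all eigenvectors of a shear stress *)

(** The characteristic polynomial has odd degree 3, hence a root in the real field. *)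
Lemma eigenvector_mx3 A : exists (l : R) v, v != 0 /\ v *m A = l *: v.
Proof.
have [|l] := @odd_poly_root R (char_poly A); first by rewrite size_char_poly.
by rewrite -eigenvalue_root_char => /eigenvalueP [v vA v0]; exists l, v.
Qed.

(* B has an eigenvector, which is a multiple of (1, 1, 0), (1, -1, 0) or e3;
   a second one exists in the complementary plane, explicitly by the quadratic
   formula, and must again be one of these. *)
Lemma eigenvectors_of_shear_stress B (s : R) : Sym B -> s != 0 ->
  (forall l v, v != 0 -> v *m B = l *: v ->
     exists m, v *m mx33 0 s 0 s 0 0 0 0 0 = m *: v) ->
  exists p q r : R, B = mx33 p q 0 q p 0 0 0 r.
Proof.
rewrite (mx33E B) /Sym tr_mx33.
move: (B 0 0) (B 0 1) (B 0 2) (B 1 0) (B 1 1) (B 1 2) (B 2 0) (B 2 1) (B 2 2).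
move=> x y u y' z w u' w' r symB s0.
have [Ey [Eu Ew]] : y' = y /\ (u' = u /\ w' = w).
  move/matrixP: symB => E; move: (E 0 1) (E 0 2) (E 1 2).
  by rewrite !mxE /= => -> -> ->.
move: {symB} Ey Eu Ew => -> -> ->.
set C := mx33 x y u y z w u w r => eig.
(* The stress sends (a, b, c) to (s b, s a, 0). A zero eigenvalue [m] forces a = b = 0; otherwise c
   = 0, and s b = m a with s a = m b gives b^2 = a^2. *)
have eig3 (l a b c : R) : row3 a b c != 0 ->
    x * a + y * b + u * c = l * a -> y * a + z * b + w * c = l * b ->
    u * a + w * b + r * c = l * c ->
    (a = 0 /\ b = 0) \/ (c = 0 /\ (b = a \/ b = - a)).
  move=> v0 E1 E2 E3; have [|m] := eig l _ v0.
    rewrite scale_row3 mul_row3_mx33.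
    by congr row3; [rewrite -E1|rewrite -E2|rewrite -E3]; ring.
  rewrite scale_row3 mul_row3_mx33 => /row3_inj[F1 F2 F3].
  have [m0|m0] := eqVneq m 0.
    left; rewrite m0 in F1 F2.
    by split; apply: (mulfI s0); [move: F2|move: F1]; lra.
  right; have c0 : c = 0 by apply: (mulfI m0); move: F3; lra.
  split=> //.
  have : s * (b - a) * (b + a) = 0.
    have -> : s * (b - a) * (b + a) = b * (s * b) - a * (s * a) by ring.
    have -> : s * b = m * a by move: F1; lra.
    have -> : s * a = m * b by move: F2; lra.
    ring.
  move/eqP; rewrite -mulrA mulf_eq0 (negPf s0) /= mulf_eq0 subr_eq0 addr_eq0.
  by case/orP => /eqP ->; [left|right].
suff [u0 w0 zx] : [/\ u = 0, w = 0 & z = x].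
  by exists x, y, r; rewrite /C u0 w0 zx.
have [l [v []]] := eigenvector_mx3 C.
rewrite (row3E v); move: (v 0 0) (v 0 1) (v 0 2) => {v} a b c v0.
rewrite scale_row3 mul_row3_mx33 => /row3_inj[E1 E2 E3].
have [] := eig3 l _ _ _ v0; try by [move: E1; lra|move: E2; lra|move: E3; lra].
  (* First case: e3 is an eigenvector, so [C] splits into a 2 x 2 block and [r], and only z = x is
     left to prove. *)
  move=> [a0 b0]; move: v0; rewrite a0 b0 row3_eq0 eqxx /= => c0.
  have u0 : u = 0 by apply: (mulfI c0); move: E1; rewrite a0 b0; lra.
  have w0 : w = 0 by apply: (mulfI c0); move: E2; rewrite a0 b0; lra.
  split=> //.
  (* If y = 0, then e1 is an eigenvector of [C], which [eig3] rules out. *)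
  have [y0|y0] := eqVneq y 0.
    have [|||| [/eqP] | [_ [] /eqP]] := eig3 x 1 0 0; rewrite ?u0 ?w0 ?y0.
    - by rewrite row3_eq0 oner_eq0.
    - by ring.
    - by ring.
    - by ring.
    - by rewrite oner_eq0.
    - by rewrite eq_sym oner_eq0.
    - by rewrite eq_sym oppr_eq0 oner_eq0.
  (* [d] is the root of the discriminant of the 2 x 2 block and [k] its larger eigenvalue, so (k -
     x)(k - z) = y^2 and (y, k - x, 0) is an eigenvector. By [eig3], k - x is y or -y; comparing the
     two expressions for y^2 gives (k - x)(z - x) = 0. *)
  pose d := Num.sqrt ((x - z) ^+ 2 + 4 * y ^+ 2).
  have dE : d ^+ 2 = (x - z) ^+ 2 + 4 * y ^+ 2.
    by apply/sqr_sqrtr/addr_ge0; [exact: sqr_ge0|apply/mulr_ge0/sqr_ge0].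
  pose k := (x + z + d) / 2; have dk : d = 2 * k - x - z by rewrite /k; field.
  rewrite dk in dE.
  have [|||| |[_ kx]] := eig3 k y (k - x) 0; rewrite ?u0 ?w0.
  - by rewrite row3_eq0 (negPf y0).
  - by ring.
  - by nra.
  - by ring.
  - by case=> yz _; rewrite yz eqxx in y0.
  have k2 : (k - x) ^+ 2 = y ^+ 2 by case: kx => ->; ring.
  have : (k - x) * (z - x) = 0 by nra.
  move/eqP; rewrite mulf_eq0 => /orP[/eqP kx0|/eqP]; last by lra.
  by move: y0; rewrite -sqrf_eq0 -k2 kx0 expr0n eqxx.
move=> [c0 ba].
(* Second case: the eigenvector is a multiple of (1, e, 0), where the sign [e] treats e1 + e2 and e1
   - e2 together. *)
have [e [e2 be]] : exists e : R, e ^+ 2 = 1 /\ b = e * a.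
  by case: ba => ->; [exists 1|exists (-1)]; split; ring.
have a0 : a != 0.
  by apply: contra v0 => /eqP a0; rewrite row3_eq0 be c0 a0 mulr0 !eqxx.
have H1 : x + e * y = l by apply: (mulfI a0); move: E1; rewrite be c0; lra.
have H2 : y + e * z = e * l by apply: (mulfI a0); move: E2; rewrite be c0; lra.
have H3 : u + e * w = 0 by apply: (mulfI a0); move: E3; rewrite be c0; lra.
have zx : z = x.
  have -> : z = e ^+ 2 * z by rewrite e2 mul1r.
  have -> : x = e ^+ 2 * (x + e * y) - e * y by rewrite e2; ring.
  have -> : e ^+ 2 * z = e * (y + e * z) - e * y by ring.
  by rewrite H2 H1; ring.
have wu : w = - (e * u).
  have -> : w = e ^+ 2 * w by rewrite e2 mul1r.
  have -> : u = - (e * w) by move: H3; lra.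
  ring.
suff u0 : u = 0 by split=> //; rewrite wu u0; ring.
apply/eqP/negPn/negP => u0.
(* On the complementary plane with basis (1, -e, 0), e3, the matrix acts by the rows (m, 2u), (u,
   r). Its larger eigenvalue [k] satisfies (k - m)(k - r) = 2 u^2, with eigenvector u (1, -e, 0) +
   (k - m) e3. Since u is nonzero, [eig3] forces k = m, and then u = 0. *)
pose m := x - e * y; pose d := Num.sqrt ((m - r) ^+ 2 + 8 * u ^+ 2).
have dE : d ^+ 2 = (m - r) ^+ 2 + 8 * u ^+ 2.
  by apply/sqr_sqrtr/addr_ge0; [exact: sqr_ge0|apply/mulr_ge0/sqr_ge0].
pose k := (m + r + d) / 2; have dk : d = 2 * k - m - r by rewrite /k; field.
rewrite dk in dE.
have K : (k - m) * (k - r) = 2 * u ^+ 2 by nra.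
have [|||| |[km _]] := eig3 k u (- (e * u)) (k - m).
- by rewrite row3_eq0 (negPf u0).
- by rewrite /m; ring.
- have Ey : e ^+ 2 * y = y by rewrite e2 mul1r.
  by rewrite wu zx /m -{1}Ey; ring.
- have Eu : e ^+ 2 * u ^+ 2 = u ^+ 2 by rewrite e2 mul1r.
  have -> : u * u + w * - (e * u) = u ^+ 2 + e ^+ 2 * u ^+ 2 by rewrite wu; ring.
  by rewrite Eu; move: K; lra.
- by case=> /eqP; rewrite (negPf u0).
by move: K; rewrite km mul0r => /eqP; rewrite eq_sym mulf_eq0 pnatr_eq0 sqrf_eq0 (negPf u0).
Qed.

(** * Positive definiteness, the factorization, and the block form of B *)

Lemma SymPos_gram F : GLpos F -> SymPos (F *m F^T).
Proof.
move=> detF; split=> [|x x0]; first by rewrite /Sym trmx_mul trmxK.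
have uF : F \in unitmx by rewrite unitmxE unitfE gt_eqF.
have y0 : x^T *m F != 0.
  apply: contra x0 => /eqP E; rewrite -[x]trmxK -[x^T](mulmxK uF) E.
  by rewrite mul0mx trmx0.
by have := mulmx_tr_gt0 y0; rewrite trmx_mul trmxK !mulmxA.
Qed.

Lemma SymPos_block (p q r : R) :
  SymPos (mx33 p q 0 q p 0 0 0 r) -> `|q| < p /\ 0 < r.
Proof.
case=> _ pos.
have form (x y z : R) : row3 x y z != 0 ->
    0 < p * (x ^+ 2 + y ^+ 2) + 2 * q * x * y + r * z ^+ 2.
  move=> v0; have := pos (row3 x y z)^T; rewrite trmx_eq0 trmxK => /(_ v0).
  rewrite mul_row3_mx33 !mxE !big_ord_recl big_ord0 !mxE /=.
  by congr (_ < _); ring.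
(* On the eigenvectors e1 + e2, e1 - e2 and e3 the form takes the values 2(p + q), 2(p - q) and
   r. *)
have := form 1 1 0; have := form 1 (-1) 0; have := form 0 0 1.
rewrite !row3_eq0 oner_eq0 !andbF => /(_ isT) H1 /(_ isT) H2 /(_ isT) H3.
by rewrite ltr_norml; split; [apply/andP; split|]; lra.
Qed.

Lemma shear_factorization (p q r : R) F : `|q| < p -> 0 < r ->
  (GLpos F /\ F *m F^T = mx33 p q 0 q p 0 0 0 r) <->
  (exists Q, SO Q /\
     F = mx33 1 (q / p) 0 0 1 0 0 0 1
         *m mx33 (Num.sqrt ((p ^+ 2 - q ^+ 2) / p)) 0 0
                 0 (Num.sqrt p) 0 0 0 (Num.sqrt r)
         *m Q).
Proof.
move=> qp r0; have p0 : 0 < p by apply: le_lt_trans qp.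
have pq : 0 < (p ^+ 2 - q ^+ 2) / p.
  move: qp; rewrite ltr_norml => /andP[q1 q2].
  by rewrite divr_gt0 // subr_sqr mulr_gt0 //; lra.
set a := Num.sqrt _; set b := Num.sqrt _; set c := Num.sqrt _.
have aE : a ^+ 2 = (p ^+ 2 - q ^+ 2) / p by rewrite sqr_sqrtr // ltW.
have bE : b ^+ 2 = p by rewrite sqr_sqrtr // ltW.
have cE : c ^+ 2 = r by rewrite sqr_sqrtr // ltW.
have abc : 0 < a * b * c by rewrite !mulr_gt0 ?sqrtr_gt0.
set M := _ *m mx33 a 0 0 0 b 0 0 0 c.
have MM : M *m M^T = mx33 p q 0 q p 0 0 0 r.
  rewrite /M !mul_mx33 tr_mx33 mul_mx33.
  have pn0 : p != 0 by rewrite gt_eqF.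
  congr mx33; try ring.
  (* The corner entry is (p^2 - q^2)/p + q^2/p = p, which is what dictates the choice of [a]. *)
  - transitivity (a ^+ 2 + (q / p) ^+ 2 * b ^+ 2); first by ring.
    by rewrite aE bE; field.
  - transitivity (q / p * b ^+ 2); first by ring.
    by rewrite bE divfK.
  - transitivity (q / p * b ^+ 2); first by ring.
    by rewrite bE divfK.
  - by rewrite -bE; ring.
  - by rewrite -cE; ring.
have detM : 0 < \det M.
  by rewrite det_mulmx !det_mx33; move: abc; congr (_ < _); ring.
have uM : M \in unitmx by rewrite unitmxE unitfE gt_eqF.
split=> [[detF FF]|[Q [[QQ detQ] ->]]]; last first.
  split; first by rewrite /GLpos det_mulmx detQ mulr1.
  by rewrite trmx_mul mulmxA -(mulmxA M) QQ mulmx1.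
exists (invmx M *m F); split; last by rewrite mulKVmx.
have QQ : invmx M *m F *m (invmx M *m F)^T = 1%:M.
  rewrite trmx_mul mulmxA -(mulmxA _ F) FF -MM mulmxA mulVmx // mul1mx.
  by rewrite -trmx_mul mulVmx // trmx1.
(* Orthogonality gives determinant 1 or -1; the positive determinants of [M] and [F] exclude -1. *)
split=> //; have := congr1 determinant QQ.
rewrite det_mulmx det_tr det1 -expr2 => /eqP; rewrite sqrf_eq1.
case/orP=> /eqP // detQ; have : 0 < \det (invmx M *m F).
  by rewrite det_mulmx det_inv mulr_gt0 ?invr_gt0.
by rewrite detQ; lra.
Qed.

Lemma char_poly_block (p q r : R) :
  char_poly (mx33 p q 0 q p 0 0 0 r) =
  ('X - (p + q)%:P) * ('X - (p - q)%:P) * ('X - r%:P).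
Proof.
rewrite /char_poly det_mx3 !mxE /= !rmorphD !rmorphN /=.
by rewrite !mulr0n !mulr1n rmorph0; ring.
Qed.

Lemma pure_shear_stress_block (sigma : 'M[R]_3 -> 'M[R]_3) B (s : R) :
  isotropic_stress_response sigma ->
  (forall B', SymPos B' -> (sigma B' = 0 <-> B' = 1%:M)) ->
  SymPos B -> sigma B = mx33 0 s 0 s 0 0 0 0 0 ->
  exists p q r : R, B = mx33 p q 0 q p 0 0 0 r.
Proof.
move=> iso sigma0 posB sB; have [s0|s0] := eqVneq s 0.
  exists 1, 0, 1; have -> : B = 1%:M.
    by apply/(sigma0 B posB); rewrite sB s0 [RHS]mx33E !mxE.
  by rewrite [LHS]mx33E !mxE.
apply: (eigenvectors_of_shear_stress (proj1 posB) s0) => l v v0 vB.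
by rewrite -sB; apply: isotropic_eigenvector iso posB v0 vB.
Qed.

End Mx33.

Theorem proposition2p8 (R : realType) :
  (forall p q r : R, `|q| < p -> 0 < r ->
     let B := mx33 p q 0
                   q p 0
                   0 0 r in
     let a := Num.sqrt ((p ^+ 2 - q ^+ 2) / p) in
     let b := Num.sqrt p in
     let c := Num.sqrt r in
     let gamma := q / p in
     [/\ b = Num.sqrt (B 0 0),
         forall F : 'M[R]_3,
           (GLpos F /\ F *m F^T = B) <->
           (exists Q : 'M[R]_3, SO Q /\
              F = mx33 1 gamma 0
                       0 1     0
                       0 0     1
                  *m mx33 a 0 0
                          0 b 0
                          0 0 c
                  *m Q)
       & forall F : 'M[R]_3, GLpos F -> F *m F^T = B ->
           (exists l1 l2 l3 : R,
              [/\ 0 < l1, 0 < l2 & 0 < l3] /\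
              singular_values F [:: l1; l2; l3] /\
              [/\ l1 ^+ 2 = p + q, l2 ^+ 2 = p - q & l3 ^+ 2 = r]) /\
           (forall l1 l2 l3 : R,
              [/\ 0 < l1, 0 < l2 & 0 < l3] ->
              singular_values F [:: l1; l2; l3] ->
              [/\ l1 ^+ 2 = p + q, l2 ^+ 2 = p - q & l3 ^+ 2 = r] ->
              [/\ a = l1 * l2 * Num.sqrt (2 / (l1 ^+ 2 + l2 ^+ 2)),
                  b = Num.sqrt ((l1 ^+ 2 + l2 ^+ 2) / 2),
                  c = l3
                & gamma = (l1 ^+ 2 - l2 ^+ 2) / (l1 ^+ 2 + l2 ^+ 2)])])
  /\
  (forall sigma : 'M[R]_3 -> 'M[R]_3,
     isotropic_stress_response sigma ->
     (forall B' : 'M[R]_3, SymPos B' -> (sigma B' = 0 <-> B' = 1%:M)) ->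
     forall (F : 'M[R]_3) (s : R), GLpos F ->
       sigma (F *m F^T) = mx33 0 s 0
                               s 0 0
                               0 0 0 ->
       exists p q r : R, `|q| < p /\ 0 < r /\
         exists Q : 'M[R]_3, SO Q /\
           let a := Num.sqrt ((p ^+ 2 - q ^+ 2) / p) in
           let b := Num.sqrt p in
           let c := Num.sqrt r in
           let gamma := q / p in
           F = mx33 1 gamma 0
                    0 1     0
                    0 0     1
               *m mx33 a 0 0
                       0 b 0
                       0 0 c
               *m Q).

Proof.
split=> [p q r qp r0|sigma iso sigma0 F s detF sF]; last first.
  have posB := SymPos_gram detF.
  have [p [q [r BE]]] := pure_shear_stress_block iso sigma0 posB sF.
  (* The bounds on p, q, r come from the positive definiteness of F F^T. *)
  have [qp r0] : `|q| < p /\ 0 < r by apply: SymPos_block; rewrite -BE.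
  exists p, q, r; do 2!split=> //.
  exact/(shear_factorization F qp r0).
move=> B a b c gamma; split=> [|F|F detF FF].
- by rewrite mxE.
- exact: shear_factorization.
move: (qp); rewrite ltr_norml => /andP[q1 q2].
have pq0 : 0 < p + q by lra.
have pq1 : 0 < p - q by lra.
have p0 : 0 < p by lra.
split.
  exists (Num.sqrt (p + q)), (Num.sqrt (p - q)), (Num.sqrt r).
  have sqrE x : 0 < x -> Num.sqrt x ^+ 2 = x by move=> x0; rewrite sqr_sqrtr // ltW.
  split; first by rewrite !sqrtr_gt0.
  split; last by rewrite !sqrE.
  split; first by rewrite /= !sqrtr_ge0.
  (* The singular values are read off from F F^T = B, whose eigenvalues are p + q, p - q and r. *)
  rewrite char_poly_mulC ?unitmxE ?unitfE ?gt_eqF // FF char_poly_block.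
  by rewrite !big_cons big_nil !sqrE // mulr1 mulrA.
move=> l1 l2 l3 [l1_0 l2_0 l3_0] _ [E1 E2 E3].
have S : l1 ^+ 2 + l2 ^+ 2 = 2 * p by rewrite E1 E2; ring.
have D : l1 ^+ 2 - l2 ^+ 2 = 2 * q by rewrite E1 E2; ring.
rewrite S D; split.
(* The nonnegative factor l1 l2 is moved under the root as its square p^2 - q^2, giving (p^2 - q^2)
   * 2 / (2p). *)
- have l0 : 0 <= l1 * l2 by rewrite mulr_ge0 // ltW.
  rewrite -[l1 * l2](ger0_norm l0) -sqrtr_sqr -sqrtrM ?sqr_ge0 //.
  rewrite /a; congr Num.sqrt; rewrite exprMn E1 E2.
  by field; rewrite gt_eqF.
- by rewrite /b; congr Num.sqrt; field.
- by rewrite /c -E3 sqrtr_sqr ger0_norm // ltW.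
- by rewrite /gamma; field; rewrite gt_eqF.
Qed.
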